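(* Suppose the series $\sum_{n=0}^\infty a_n$ converges, with sum $s$, partial sums $s_n$ and remainders $r_n=s-s_n$, and suppose that $$\lim_{n\to\infty}\frac{r_{n+1}}{r_n}=x$$ (in particular $r_n\neq 0$ for all sufficiently large $n$). If $x\neq 1$, then for all $m\in\mathbb{N}=\{1,2,\dots\}$ $$\lim_{n\to\infty}\sum_{k=0}^{mp-1}\frac{M^{(m)}_{k+1}(n)}{M^{(m)}(n)}\cdot\frac{a_{n+k}}{r_n}=1,$$ and thus the transformation $\mathscr{Q}^{(m)}$ accelerates the convergence of $\{s_n\}$, i.e. $$\lim_{n\to\infty}\frac{\mathscr{Q}^{(m)}_n-s}{s_n-s}=0.$$
   Context: Let $p\ge 1$ be an integer, let $\alpha_1,\dots,\alpha_p,\beta_1,\dots,\beta_p\in\mathbb{C}$, none of them zero or a negative integer, and let $x\in\mathbb{C}$, $x\neq 0$. The Pochhammer symbol is $(z)_0:=1$, $(z)_n:=z(z+1)\cdots(z+n-1)$ for $n\ge 1$. Write $\langle\boldsymbol\alpha\rangle_n:=\prod_{j=1}^p(\alpha_j)_n$ and $\langle\boldsymbol\beta\rangle_n:=\prod_{j=1}^p(\beta_j)_n$. Consider the series $\sum_{n=0}^\infty a_n$ with $$a_n:=\frac{\langle\boldsymbol\alpha\rangle_n}{\langle\boldsymbol\beta\rangle_n}\,x^n,$$ partial sums $s_n:=\sum_{j=0}^{n-1}a_j$ and (when the series converges) remainders $r_n:=\sum_{j=0}^\infty a_{n+j}$. Let $\Delta$ be the forward difference operator acting on $n$: $\Delta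 z_n:=z_{n+1}-z_n$, $\Delta^0z_n:=z_n$, $\Delta^kz_n:=\Delta(\Delta^{k-1}z_n)$. For $m\in\mathbb{N}$ define the linear operator $\mathbb{L}^{(m)}_n$ on sequences by $$\mathbb{L}^{(m)}_n(z_n):=\Delta^{mp}\left(\frac{\langle\boldsymbol\beta\rangle_{n+m-1}}{\langle\boldsymbol\alpha\rangle_n\,x^n}\,z_n\right),$$ and the transformation $\mathscr{Q}^{(m)}$ by $$\mathscr{Q}^{(m)}_n:=\frac{\mathbb{L}^{(m)}_n(s_n)}{\mathbb{L}^{(m)}_n(1)},$$ where $1$ denotes the constant sequence. For $0\le j\le mp$ put $$\lambda^{(m)}_j(n):=\frac{\langle\boldsymbol\alpha\rangle_{n+mp}\,x^{n+mp}}{\langle\boldsymbol\beta\rangle_{n+m-1}}\left[(-1)^{mp-j}\binom{mp}{j}\frac{\langle\boldsymbol\beta\rangle_{n+j+m-1}}{\langle\boldsymbol\alpha\rangle_{n+j}\,x^{n+j}}\right]$$ (equivalently, $\lambda^{(m)}_j(n)=\binom{mp}{j}(-x)^{mp-j}\prod_{i=1}^p[(\alpha_i+n+j)_{mp-j}(\beta_i+n+m-1)_j]$, a polynomial in $n$), and $$M^{(m)}_k(n):=\sum_{j=k}^{mp}\lambda^{(m)}_j(n)\quad(k=0,1,\dots,mp),\qquad M^{(m)}(n):=M^{(m)}_0(n).$$ The denominator $\mathbb{L}^{(m)}_n(1)$ is nonzero exactly when $M^{(m)}(n)\ne 0$. All quotients in the limits are considered for those sufficiently large $n$ for which they are defined.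 *)

(* Defs.v *)
From mathcomp Require Import all_boot all_order all_algebra.
From mathcomp Require Import complex.
From mathcomp Require Import all_classical all_reals all_analysis.

Set Implicit Arguments.
Unset Strict Implicit.
Unset Printing Implicit Defensive.

Import Order.TTheory GRing.Theory Num.Theory.
Import numFieldNormedType.Exports.

Local Open Scope classical_set_scope.
Local Open Scope ring_scope.

Section Definitions.
Variable F : fieldType.

Definition pochhammer (z : F) (n : nat) : F := \prod_(i < n) (z + i%:R).

Definition mpochhammer (p : nat) (c : 'I_p -> F) (n : nat) : F :=
  \prod_(j < p) pochhammer (c j) n.

(* The library's [telescope] sends u to n |-> u n.+1 - u n. *)
Definition fwd_diff (k : nat) (z : nat -> F) : nat -> F := iter k telescope z.

Section Hypergeometric.
Variables (p : nat) (alpha beta : 'I_p -> F) (x : F).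

Definition term (n : nat) : F :=
  mpochhammer alpha n / mpochhammer beta n * x ^+ n.

(* [series u n] is the sum of the n terms u 0, ..., u n.-1. *)
Definition partial_sum : nat -> F := series term.

Definition remainder (s : F) (n : nat) : F := s - partial_sum n.

(* In the definitions below m is positive, so that the truncated
   subtraction (n + m - 1)%N is the usual one. *)

Definition opL (m : nat) (z : nat -> F) : nat -> F :=
  fwd_diff (m * p)
    (fun n => mpochhammer beta (n + m - 1) / (mpochhammer alpha n * x ^+ n)
              * z n).

Definition transQ (m n : nat) : F :=
  opL m partial_sum n / opL m (fun=> 1) n.

Definition lambda (m j n : nat) : F :=
  mpochhammer alpha (n + m * p) * x ^+ (n + m * p)
    / mpochhammer beta (n + m - 1)
  * ((-1) ^+ (m * p - j) * 'C(m * p, j)%:R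
     * (mpochhammer beta (n + j + m - 1)
        / (mpochhammer alpha (n + j) * x ^+ (n + j)))).

Definition Mtail (m k n : nat) : F := \sum_(k <= j < (m * p).+1) lambda m j n.

End Hypergeometric.
End Definitions.

(* Main.v *)
Require Import Defs.
From mathcomp Require Import all_boot all_order all_algebra.
From mathcomp Require Import complex.
From mathcomp Require Import all_classical all_reals all_analysis.
From mathcomp Require Import ring.
Import Order.TTheory GRing.Theory Num.Theory.
Import numFieldNormedType.Exports.
Local Open Scope classical_set_scope.
Local Open Scope ring_scope.

(** Let N = mp, let w_n be the weight inside the difference operator, and put
    c_j = (-1)^(N-j) binom(N, j), so that L(z)_n = sum_j c_j w_(n+j) z_(n+j) and
    lambda_j(n) is c_j w_(n+j) times a nonzero factor independent of j.  Since
    w_(n+1) / w_n --> 1/x and r_(n+1) / r_n --> x, we get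
    L(1)_n / w_n --> (1/x - 1)^N <> 0, whereas
    L(r)_n / (w_n r_n) --> sum_j c_j x^-j x^j = (1 - 1)^N = 0.  Hence
    (Q_n - s) / (s_n - s) = L(r)_n / (L(1)_n r_n) --> 0, and summation by parts,
    with a_n = r_n - r_(n+1), shows that the sum in the first limit equals
    1 - L(r)_n / (L(1)_n r_n). *)

(** * Finite differences and summation by parts *)

Lemma fwd_diff_binomial (F : fieldType) (N : nat) (z : nat -> F) (n : nat) :
  fwd_diff N z n =
  \sum_(0 <= j < N.+1) (-1) ^+ (N - j) * 'C(N, j)%:R * z (n + j)%N.
Proof.
elim: N n => [|N IH] n.
  by rewrite big_nat1 /= subnn bin0 !mul1r addn0.
rewrite /fwd_diff iterS /telescope /= -/(fwd_diff N z) !IH.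
(* Once the end terms are split off, all sums run over the same indices and agree term by term by
   Pascal's rule. *)
rewrite [in RHS]big_nat_recl // [in RHS]big_nat_recr //=.
rewrite [X in X - _]big_nat_recr //= [X in _ - X]big_nat_recl //=.
rewrite (@eq_big_nat _ _ _ 0 N
  (fun i => (-1) ^+ (N.+1 - i.+1) * 'C(N.+1, i.+1)%:R * z (n + i.+1)%N)
  (fun i => (-1) ^+ (N - i) * 'C(N, i)%:R * z (n.+1 + i)%N
          - (-1) ^+ (N - i.+1) * 'C(N, i.+1)%:R * z (n + i.+1)%N)); last first.
  move=> i /= iN; rewrite subSS binS natrD addSnnS.
  by rewrite -(subnSK iN) exprS; ring.
rewrite big_split /= sumrN addSnnS subSS !subn0 !subnn !binn !bin0 exprS; ring.
Qed.

(** Each [t j] occurs in the tails with [k < j], and the differences over those [k] telescope. *)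
Lemma sum_tail_diff (F : pzRingType) (N : nat) (t r : nat -> F) :
  \sum_(0 <= k < N) (\sum_(k.+1 <= j < N.+1) t j) * (r k - r k.+1) =
  \sum_(0 <= j < N.+1) t j * (r 0%N - r j).
Proof.
elim: N => [|N IH]; first by rewrite big_geq // big_nat1 subrr mulr0.
rewrite [RHS]big_nat_recr //= -IH big_nat_recr //= big_nat1.
under eq_big_nat => k /andP[_ kN] do rewrite big_nat_recr 1?ltnW //= mulrDl.
rewrite big_split /= -addrA; congr (_ + _).
rewrite -mulr_sumr -mulrDr -(big_nat_recr _ _ (fun k => r k - r k.+1)) //.
congr (_ * _); under eq_bigr do rewrite -opprB.
by rewrite sumrN telescope_sumr // opprB.
Qed.

(** * Sequences whose consecutive ratios converge *)

Section NumFieldSequences.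
Variable K : numFieldType.
Implicit Types (u w r : nat -> K) (l x : K).

Lemma near_eq_cvg_seq {u l} (v : nat -> K) : (\forall n \near \oo, u n = v n) ->
  u @ \oo --> l -> v @ \oo --> l.
Proof. by move=> uv; apply: cvg_trans; exact: near_eq_cvg. Qed.

(** Since division by 0 gives 0, a zero of [u] makes the ratio 0, which is excluded for large [n] by
    the nonzero limit. *)
Lemma cvg_ratio_neq0 {u l} : l != 0 -> (fun n => u n.+1 / u n) @ \oo --> l ->
  \forall n \near \oo, u n != 0.
Proof.
move=> l0 ul; near=> n; have : u n.+1 / u n != 0.
  by near: n; exact: (cvgr_neq0 l ul l0).
by apply: contra_neq => ->; rewrite invr0 mulr0.
Unshelve. all: end_near. Qed.

(** The quotient is a telescoping product of [j] shifted ratios; the cancellation is licit where [u]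
    has no zeros. *)
Lemma cvg_ratio_iter {u l} j : l != 0 -> (fun n => u n.+1 / u n) @ \oo --> l ->
  (fun n => u (n + j)%N / u n) @ \oo --> l ^+ j.
Proof.
move=> l0 ul; have u0 := cvg_ratio_neq0 l0 ul.
elim: j => [|j IH].
  rewrite expr0; apply: near_eq_cvg_seq (cvg_cst (1 : K)); near=> n.
  rewrite addn0 divff //.
  by near: n.
rewrite exprS.
have ujl : (fun n => u (n + j).+1 / u (n + j)%N) @ \oo --> l.
  exact: (cvg_comp (addn^~ j) (fun n => u n.+1 / u n) (cvg_addnr j) ul).
apply: near_eq_cvg_seq (cvgM ujl IH); near=> n.
rewrite /= mulrA divfK ?addnS //.
by near: n; exact: (cvg_addnr j _ u0).
Unshelve. all: end_near. Qed.

Lemma cvg_big_sum (m n : nat) (f : nat -> nat -> K) (l : nat -> K) :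
  (forall j, f j @ \oo --> l j) ->
  (fun k => \sum_(m <= j < n) f j k) @ \oo --> \sum_(m <= j < n) l j.
Proof. by move=> fl; apply: (cvg_big add_continuous) => j _; exact: fl. Qed.

Definition altbin (N j : nat) : K := (-1) ^+ (N - j) * 'C(N, j)%:R.

Lemma sum_altbin (N : nat) (y : K) :
  \sum_(0 <= j < N.+1) altbin N j * y ^+ j = (y - 1) ^+ N.
Proof.
rewrite addrC exprDn big_mkord; apply: eq_bigr => j _.
by rewrite /altbin -[RHS]mulr_natr mulrAC.
Qed.

Lemma altbin_weighted_cvg (N : nat) {w x} : x != 0 ->
  (fun n => w n.+1 / w n) @ \oo --> x^-1 ->
  (fun n => \sum_(0 <= j < N.+1) altbin N j * (w (n + j)%N / w n)) @ \oo -->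
  (x^-1 - 1) ^+ N.
Proof.
move=> x0 wx; rewrite -sum_altbin; apply: cvg_big_sum => j.
apply: cvgM; first exact: cvg_cst.
by apply: cvg_ratio_iter => //; rewrite invr_eq0.
Qed.

Lemma altbin_weighted_neq0 (N : nat) {w x} : x != 0 -> x != 1 ->
  (fun n => w n.+1 / w n) @ \oo --> x^-1 ->
  \forall n \near \oo, \sum_(0 <= j < N.+1) altbin N j * w (n + j)%N != 0.
Proof.
move=> x0 x1 wx.
have y0 : (x^-1 - 1) ^+ N != 0 by rewrite expf_neq0 // subr_eq0 invr_eq1.
have D0 := cvgr_neq0 _ (altbin_weighted_cvg N x0 wx) y0.
near=> n; have : \sum_(0 <= j < N.+1) altbin N j * (w (n + j)%N / w n) != 0.
  by near: n; exact: D0.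
by under eq_bigr do rewrite mulrA; rewrite -mulr_suml mulf_eq0 => /norP[].
Unshelve. all: end_near. Qed.

Lemma weighted_ratio_cvg0 {N : nat} {w r x} : (0 < N)%N -> x != 0 -> x != 1 ->
  (fun n => w n.+1 / w n) @ \oo --> x^-1 ->
  (fun n => r n.+1 / r n) @ \oo --> x ->
  (fun n => (\sum_(0 <= j < N.+1) altbin N j * (w (n + j)%N * r (n + j)%N)) /
            ((\sum_(0 <= j < N.+1) altbin N j * w (n + j)%N) * r n)) @ \oo --> (0 : K).
Proof.
move=> N0 x0 x1 wx rx.
have xV0 : x^-1 != 0 by rewrite invr_eq0.
have num0 : (fun n => \sum_(0 <= j < N.+1)
    altbin N j * (w (n + j)%N / w n * (r (n + j)%N / r n))) @ \oo --> (0 : K).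
  rewrite [X in _ --> X](_ : _ =
      \sum_(0 <= j < N.+1) altbin N j * (x^-1 ^+ j * x ^+ j)); last first.
    under eq_bigr do rewrite -exprMn mulVf //.
    by rewrite sum_altbin subrr expr0n eqn0Ngt N0.
  apply: cvg_big_sum => j; apply: cvgM; first exact: cvg_cst.
  by apply: cvgM; apply: cvg_ratio_iter.
have den := altbin_weighted_cvg N x0 wx.
have y0 : (x^-1 - 1) ^+ N != 0 by rewrite expf_neq0 // subr_eq0 invr_eq1.
(* The numerator is normalised by [w n * r n] and the denominator sum by [w n]; only the latter
   limit must be nonzero. *)
rewrite -[X in _ --> X](mul0r ((x^-1 - 1) ^+ N)^-1).
apply: near_eq_cvg_seq (cvgM num0 (cvgV y0 den)); near=> n.
have wn : w n != 0 by near: n; exact: cvg_ratio_neq0 wx.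
have rn : r n != 0 by near: n; exact: cvg_ratio_neq0 rx.
rewrite /= [X in X * _](_ : _ = (\sum_(0 <= j < N.+1)
    altbin N j * (w (n + j)%N * r (n + j)%N)) * (w n * r n)^-1); last first.
  by rewrite mulr_suml; apply: eq_bigr => j _; rewrite mulf_div !mulrA.
under [X in _ * X^-1 = _]eq_bigr do rewrite mulrA.
rewrite -mulr_suml !invfM invrK -!mulrA; congr (_ * _).
by rewrite mulrC -!mulrA mulfV // mulr1 mulrC.
Unshelve. all: end_near. Qed.

(** * Pochhammer products and the asymptotics of the weights *)

Definition not_nonpos_int (z : K) : Prop := forall k : nat, z != - k%:R.

Lemma mpochhammerS (p : nat) (c : 'I_p -> K) (n : nat) :
  mpochhammer c n.+1 = mpochhammer c n * \prod_(j < p) (c j + n%:R).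
Proof.
rewrite /mpochhammer -big_split; apply: eq_bigr => j _.
by rewrite /pochhammer big_ord_recr.
Qed.

Lemma mpochhammer_neq0 (p : nat) (c : 'I_p -> K) (n : nat) :
  (forall j, not_nonpos_int (c j)) -> mpochhammer c n != 0.
Proof.
move=> c0; apply/prodf_neq0 => j _; apply/prodf_neq0 => i _.
by rewrite addr_eq0; exact: c0.
Qed.

(** After division by [n.+1], numerator and denominator both have the form 1 + (c - 1)/(n + 1). *)
Lemma cvg_translate_ratio (a b : K) :
  (fun n => n.+1%:R^-1 : K) @ \oo --> (0 : K) ->
  (fun n => (b + n%:R) / (a + n%:R)) @ \oo --> (1 : K).
Proof.
move=> h.
have E c : (fun n => (c + n%:R) / n.+1%:R) @ \oo --> (1 : K).
  have -> : (fun n => (c + n%:R) / n.+1%:R) =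
            (fun n => 1 + (c - 1) * n.+1%:R^-1).
    apply/funext => n; rewrite -[n.+1]add1n natrD; field.
    by rewrite -(natrD _ 1 n) pnatr_eq0.
  rewrite -[X in _ --> X]addr0 -[X in _ --> _ + X](mulr0 (c - 1)).
  by apply: cvgD; [exact: cvg_cst|apply: cvgM => //; exact: cvg_cst].
rewrite -[X in _ --> X](divff (oner_neq0 K)).
apply: near_eq_cvg_seq (cvgM (E b) (cvgV (oner_neq0 K) (E a))); near=> n.
by rewrite /= invfM invrK mulrACA mulVf ?mulr1 // pnatr_eq0.
Unshelve. all: end_near. Qed.

(* An abstract numFieldType, and R[i] in particular, has no archimedean
   instance, so that n^-1 --> 0 is a hypothesis here. *)
Section Weights.
Variables (p : nat) (alpha beta : 'I_p -> K) (x : K).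
Hypothesis harmonic0 : (fun n => n.+1%:R^-1 : K) @ \oo --> (0 : K).
Hypothesis alpha_nni : forall j, not_nonpos_int (alpha j).
Hypothesis beta_nni : forall j, not_nonpos_int (beta j).
Hypothesis x_neq0 : x != 0.

Definition weight (m n : nat) : K :=
  mpochhammer beta (n + m - 1) / (mpochhammer alpha n * x ^+ n).

(** There are as many [alpha j] as [beta j], so the ratio is [x^-1] times [p] quotients, each
    tending to 1. *)
Lemma weight_ratio_cvg (m : nat) : (0 < m)%N ->
  (fun n => weight m n.+1 / weight m n) @ \oo --> x^-1.
Proof.
(* With [m.+1] for [m], the truncated [n + m.+1 - 1] becomes [n + m]. *)
case: m => // m _.
have -> : (fun n => weight m.+1 n.+1 / weight m.+1 n) = (fun n =>
   (\prod_(j < p) ((beta j + m%:R + n%:R) / (alpha j + n%:R))) * x^-1).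
  apply/funext => n; rewrite big_split /= prodfV.
  have -> : \prod_(j < p) (beta j + m%:R + n%:R) =
            \prod_(j < p) (beta j + (n + m)%:R).
    by apply: eq_bigr => j _; rewrite natrD addrAC addrA.
  rewrite /weight !addnS !subn1 /= addSn !mpochhammerS exprS.
  have an : mpochhammer alpha n != 0 by exact: mpochhammer_neq0.
  have bn : mpochhammer beta (n + m) != 0 by exact: mpochhammer_neq0.
  have := mpochhammer_neq0 p alpha n.+1 alpha_nni.
  rewrite mpochhammerS mulf_eq0 negb_or => /andP[_ an1].
  by field; rewrite x_neq0 an1 expf_neq0 // an.
have ratio1 : (fun n => \prod_(j < p) ((beta j + m%:R + n%:R) / (alpha j + n%:R)))
    @ \oo --> \prod_(j < p) (1 : K).
  by apply: (cvg_big mul_continuous) => j _; exact: cvg_translate_ratio.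
have := cvgM ratio1 (cvg_cst x^-1); rewrite big1 // mul1r; exact.
Qed.

Lemma opL_altbin (m : nat) (z : nat -> K) (n : nat) :
  opL alpha beta x m z n =
  \sum_(0 <= j < (m * p).+1) altbin (m * p) j * (weight m (n + j) * z (n + j)%N).
Proof. exact: fwd_diff_binomial. Qed.

(** The prefactor is independent of [k], so it cancels in quotients of tails. *)
Lemma Mtail_altbin (m k n : nat) :
  Mtail alpha beta x m k n =
  mpochhammer alpha (n + m * p) * x ^+ (n + m * p) / mpochhammer beta (n + m - 1)
  * \sum_(k <= j < (m * p).+1) altbin (m * p) j * weight m (n + j).
Proof. by rewrite mulr_sumr. Qed.

Lemma term_remainder (s : K) (n : nat) :
  term alpha beta x n =
  remainder alpha beta x s n - remainder alpha beta x s n.+1.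
Proof.
rewrite -[in LHS](seriesK (term alpha beta x)) /telescope /remainder /partial_sum /=.
by ring.
Qed.

Lemma Q_acceleration (m : nat) (s : K) : (0 < m)%N -> (0 < p)%N -> x != 1 ->
  (fun n => remainder alpha beta x s n.+1 / remainder alpha beta x s n)
    @ \oo --> x ->
  [/\ \forall n \near \oo,
        [/\ remainder alpha beta x s n != 0,
            Mtail alpha beta x m 0 n != 0
          & opL alpha beta x m (fun=> 1) n != 0],
      (fun n : nat => \sum_(0 <= k < m * p)
          (Mtail alpha beta x m k.+1 n / Mtail alpha beta x m 0 n
           * (term alpha beta x (n + k) / remainder alpha beta x s n)))
        @ \oo --> (1 : K)
    & (fun n : nat => (transQ alpha beta x m n - s)
                      / (partial_sum alpha beta x n - s))
        @ \oo --> (0 : K)].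
Proof.
move=> m0 p0 x1 rx; set N := (m * p)%N; set r := remainder alpha beta x s.
have N0 : (0 < N)%N by rewrite muln_gt0 m0.
have wx := weight_ratio_cvg _ m0.
pose D n := \sum_(0 <= j < N.+1) altbin N j * weight m (n + j).
pose E n := \sum_(0 <= j < N.+1) altbin N j * (weight m (n + j) * r (n + j)%N).
have D0 : \forall n \near \oo, D n != 0 := altbin_weighted_neq0 N x_neq0 x1 wx.
have r0 : \forall n \near \oo, r n != 0 := cvg_ratio_neq0 x_neq0 rx.
have C0 n : mpochhammer alpha (n + N) * x ^+ (n + N)
            / mpochhammer beta (n + m - 1) != 0.
  by rewrite !mulf_neq0 ?invr_eq0 ?expf_neq0 ?mpochhammer_neq0.
have ED : (fun n => E n / (D n * r n)) @ \oo --> (0 : K).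
  exact: weighted_ratio_cvg0 N0 x_neq0 x1 wx rx.
have L1 n : opL alpha beta x m (fun=> 1) n = D n.
  by rewrite opL_altbin; apply: eq_bigr => j _; rewrite mulr1.
split.
- near=> n; split; first by near: n.
  + by rewrite Mtail_altbin mulf_neq0 //; near: n; exact: D0.
  + by rewrite L1; near: n; exact: D0.
- rewrite -[X in _ --> X]subr0.
  apply: near_eq_cvg_seq (cvgB (cvg_cst (1 : K)) ED); near=> n.
  have rn : r n != 0 by near: n.
  have Dn : D n != 0 by near: n; exact: D0.
  transitivity ((\sum_(0 <= k < N) (\sum_(k.+1 <= j < N.+1)
      altbin N j * weight m (n + j)) * (r (n + k)%N - r (n + k.+1)%N))
      / (D n * r n)).
    (* Summation by parts turns the numerator into [D n * r n - E n]. *)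
    rewrite (sum_tail_diff _ _ (fun j => altbin N j * weight m (n + j))
               (fun j => r (n + j)%N)) addn0.
    under eq_bigr do rewrite mulrBr -[X in _ - X]mulrA.
    rewrite sumrB -mulr_suml -/(D n) -/(E n) mulrBl divff ?mulf_neq0 //.
  rewrite mulr_suml; apply: eq_bigr => k _.
  rewrite (term_remainder s) !Mtail_altbin -/r -/(D n) addnS.
  by field; rewrite rn Dn expf_neq0 // !mpochhammer_neq0.
- suff QE : \forall n \near \oo, E n / (D n * r n) =
      (transQ alpha beta x m n - s) / (partial_sum alpha beta x n - s).
    exact: near_eq_cvg_seq QE ED.
  near=> n.
  have rn : r n != 0 by near: n.
  have Dn : D n != 0 by near: n; exact: D0.
  (* Linearity of the operator, applied to s_n = s - r_n. *)
  have Ls : opL alpha beta x m (partial_sum alpha beta x) n = s * D n - E n.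
    rewrite opL_altbin mulr_sumr -sumrB; apply: eq_bigr => j _.
    by rewrite /r /remainder; ring.
  rewrite /transQ L1 Ls (_ : partial_sum _ _ _ n - s = - r n); last first.
    by rewrite /r /remainder opprB.
  by field; rewrite rn Dn.
Unshelve. all: end_near. Qed.

End Weights.

End NumFieldSequences.

Lemma complex_harmonic_cvg (R : realType) :
  (fun n => n.+1%:R^-1 : R[i]^o) @ \oo --> (0 : R[i]^o).
Proof.
(* A positive element of [R[i]] has imaginary part 0, so its real part [a] serves as the bound for
   the real harmonic sequence. *)
apply/cvgrPdist_lt => -[a b]; rewrite ltcE => /= /andP[/eqP -> a0].
have /cvgrPdist_lt/(_ _ a0) H := @cvg_harmonic R.
near=> n; have Hn : `|0 - harmonic n| < a by near: n.
have -> : (0 - n.+1%:R^-1 : R[i]) = (0 - harmonic n)%:C%C.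
  by rewrite rmorphB /= rmorph0 fmorphV /= rmorph_nat.
by rewrite normc_def /= expr0n addr0 sqrtr_sqr ltcR.
Unshelve. all: end_near. Qed.

(* The ascriptions [_ : R[i]^o] select the topology of the modulus on R[i].
   Division by 0 is 0 here; the first conjunct of the conclusion says that no
   denominator vanishes for large n, so that all the limits are genuine. *)
Theorem theorem2p4 (R : realType) (p : nat) (hp : (1 <= p)%N)
    (alpha beta : 'I_p -> R[i]) (x s : R[i])
    (halpha : forall (j : 'I_p) (k : nat), alpha j != - k%:R)
    (hbeta : forall (j : 'I_p) (k : nat), beta j != - k%:R)
    (hx0 : x != 0)
    (hs : partial_sum alpha beta x @ \oo --> (s : R[i]^o))
    (hr : (fun n : nat => remainder alpha beta x s n.+1
                          / remainder alpha beta x s n)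
            @ \oo --> (x : R[i]^o))
    (hx1 : x != 1) :
  forall m : nat, (1 <= m)%N ->
  [/\ \forall n \near \oo,
        [/\ remainder alpha beta x s n != 0,
            Mtail alpha beta x m 0 n != 0
          & opL alpha beta x m (fun=> 1) n != 0],
      (fun n : nat => \sum_(0 <= k < m * p)
          (Mtail alpha beta x m k.+1 n / Mtail alpha beta x m 0 n
           * (term alpha beta x (n + k) / remainder alpha beta x s n)))
        @ \oo --> (1 : R[i]^o)
    & (fun n : nat => (transQ alpha beta x m n - s)
                      / (partial_sum alpha beta x n - s))
        @ \oo --> (0 : R[i]^o)].
Proof.
move=> m hm.
exact: (Q_acceleration R[i] p alpha beta x (complex_harmonic_cvg R) halpha hbeta
  hx0 m s hm hp hx1 hr).
Qed.
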